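(* Let $\{g^t\}_{t\ge 0}$ be the iterates generated by the Truncated Multi-Sinkhorn algorithm described in the context, with marginals $\mu=(\mu_1,\dots,\mu_K)$, cost tensors $\{c_A\}_{A\in S_K^L}$, regularization parameter $\eta>0$ and truncation level $1\le L\le K$. Then for every sufficiently small fixed $\delta'>0$, the number of iterations $T$ needed to achieve the stopping criterion $E_T\le\delta'$ satisfies $$T\;\le\;2+\left\lceil\frac{\mathcal{G}^L(g^0)}{\min_{i\in\mathcal{Y}}\|\mu_i\|_1}\right\rceil+\frac{14K^2\overline{R}}{\eta\,\delta'},$$ where $$\overline{R}:=L-\eta\log\min_{j\in\mathcal{Y},\,y\in\mathcal{X}_j}\mu_j(y)+\eta L\log(K C^* n).$$
   Context: Setting. $K\ge1$ is an integer, $\mathcal{Y}=\{1,\dots,K\}$, $1\le L\le K$. $S_K^L$ is the set of nonempty $A\subseteq\mathcal{Y}$ with $|A|\le L$, and $S_K^L(i)=\{A\in S_K^L: i\in A\}$. For each $i\in\mathcal{Y}$, $\mathcal{X}_i$ is a finite nonempty set with $n_i$ elements and $\mu_i$ is a positive measure on $\mathcal{X}_i$ with $\mu_i(x)>0$ for all $x\in\mathcal{X}_i$; moreover $\sum_{i}\|\mu_i\|_1=1$, where $\|\cdot\|_1$ is the $\ell^1$ norm (total mass). $n\ge1$ is a reference sample size ($n_i=O(n)$) and $C^*:=\max_{i\in\mathcal{Y}} n_i/n$. For $A\in S_K^L$, $\mathcal{X}^A:=\prod_{i\in A}\mathcal{X}_i$ with elements $x_A=(x_i)_{i\in A}$.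 The cost tensors $c_A:\mathcal{X}^A\to[0,\infty]$ are nonnegative (possibly $+\infty$) with $c_{\{i\}}\equiv0$ for all $i$. For $\pi_A:\mathcal{X}^A\to[0,\infty)$ and $i\in A$, ${\mathcal{P}_i}_\#\pi_A(x_i)$ is the sum of $\pi_A$ over all points of $\mathcal{X}^A$ with $i$-th coordinate $x_i$. Dual objective. For $g=(g_1,\dots,g_K)$ with $g_i:\mathcal{X}_i\to\mathbb{R}$, and $\eta>0$, $$\mathcal{G}^L(g):=\sum_{A\in S_K^L}\sum_{x_A\in\mathcal{X}^A}\exp\Big(\tfrac1\eta\big(\sum_{i\in A}g_i(x_i)-(1+c_A(x_A))\big)\Big)-\sum_{i\in\mathcal{Y}}\sum_{x_i\in\mathcal{X}_i}\frac{g_i(x_i)}{\eta}\mu_i(x_i)$$ (with $\exp(-\infty)=0$), and $\pi_A(g)(x_A):=\exp\big(\tfrac1\eta(\sum_{i\in A}g_i(x_i)-(1+c_A(x_A)))\big)$. KL divergence of positive measures on a finite set $\mathcal{Z}$ (not necessarily of equal mass): $D_{\mathrm{KL}}(\mu\|\nu):=\sum_{z}(\nu(z)-\mu(z))+\sum_z\mu(z)\log\frac{\mu(z)}{\nu(z)}$. Truncated Multi-Sinkhorn algorithm. Start with $g_i^0=\boldsymbol{0}$ for all $i$. Given $g^t$, pick $I\in\arg\max_{1\le i\le K}D_{\mathrm{KL}}\big(\mu_i\,\|\,\sum_{A\in S_K^L(i)}{\mathcal{P}_i}_\#\pi_A(g^t)\big)$ and set $g_I^{t+1}=g_I^t+\eta\log\mu_I-\eta\log\big(\sum_{A\in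 S_K^L(I)}{\mathcal{P}_I}_\#\pi_A(g^t)\big)$ (pointwise on $\mathcal{X}_I$), $g_i^{t+1}=g_i^t$ for $i\ne I$. The algorithm stops at the first iteration $t$ with $E_t\le\delta'$, where $$E_t:=\sum_{i\in\mathcal{Y}}\Big\|\mu_i-\sum_{A\in S_K^L(i)}{\mathcal{P}_i}_\#\pi_A(g^t)\Big\|_1 .$$ ''For sufficiently small $\delta'$'' means: there is $\delta_0>0$ (which may depend on all the other data) such that the claim holds for all $0<\delta'\le\delta_0$. *)

(* Defs.v *)
From HB Require Import structures.
From mathcomp Require Import all_boot all_order all_algebra.
From mathcomp Require Import reals ereal exp.

Set Implicit Arguments.
Unset Strict Implicit.
Unset Printing Implicit Defensive.

Import Order.TTheory GRing.Theory Num.Theory.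

Local Open Scope ring_scope.

Section FiniteFamilies.
Variables (R : realType) (I : finType).
Implicit Types f mu nu : I -> R.

(* The default element is a value of the family, so that these are the exact
   extrema as soon as I is nonempty (the value is 0 for empty I). *)
Definition fmin f : R := \big[Num.min/head 0 (codom f)]_(i : I) f i.
Definition fmax f : R := \big[Num.max/head 0 (codom f)]_(i : I) f i.

Definition norm1 f : R := \sum_(i : I) `|f i|.

(* The measures need not have equal mass, hence the first sum. *)
Definition KL mu nu : R :=
  \sum_(z : I) (nu z - mu z) + \sum_(z : I) mu z * ln (mu z / nu z).

End FiniteFamilies.

Section TruncatedMultiSinkhorn.
Variables (R : realType) (K : nat) (X : 'I_K -> finType).

Definition SKL (L : nat) : {set {set 'I_K}} :=
  [set A : {set 'I_K} | (A != set0) && (#|A| <= L)%N].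

Definition SKLi (L : nat) (i : 'I_K) : {set {set 'I_K}} :=
  [set A in SKL L | i \in A].

Definition XA (A : {set 'I_K}) : finType :=
  {dffun forall j : {i : 'I_K | i \in A}, X (val j)}.

(* For i in A this is x_i = xi (see has_coordE); comparing in the disjoint union
   of the X i avoids carrying a proof of i \in A. *)
Definition has_coord (A : {set 'I_K}) (x : XA A) (i : 'I_K) (xi : X i) : bool :=
  [exists j : {i : 'I_K | i \in A},
     Tagged (fun k => X k : Type) (x j) == Tagged (fun k => X k : Type) xi].

Lemma has_coordE (A : {set 'I_K}) (x : XA A) (i : 'I_K) (iA : i \in A)
    (xi : X i) :
  has_coord x xi = (x (exist _ i iA) == xi).
Proof.
apply/existsP/eqP => [[[j jA] /= /eqP e]|<-]; last by exists (exist _ i iA).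
have ji : j = i := congr1 (@tag _ _) e.
subst j; rewrite (bool_irrelevance iA jA).
by move/eqP: e; rewrite eq_Tagged => /eqP.
Qed.

Definition pushforward (A : {set 'I_K}) (p : XA A -> R) (i : 'I_K) (xi : X i) :
    R :=
  \sum_(x : XA A | has_coord x xi) p x.

Variables (mu : forall i : 'I_K, X i -> R)
  (c : forall A : {set 'I_K}, XA A -> \bar R) (eta : R) (L : nat).

Implicit Types g : forall i : 'I_K, X i -> R.

(* expeR -oo = 0, so tuples of infinite cost get no mass. *)
Definition plan g (A : {set 'I_K}) (x : XA A) : R :=
  fine (expeR ((eta^-1)%:E *
    ((\sum_(j : {i : 'I_K | i \in A}) g (val j) (x j))%R%:E
       - (1%:E + c x)))%E).

Definition dual_objective g : R :=
  \sum_(A in SKL L) \sum_(x : XA A) plan g x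
  - \sum_(i < K) \sum_(xi : X i) g i xi / eta * mu xi.

Definition marginal g (i : 'I_K) (xi : X i) : R :=
  \sum_(A in SKLi L i) pushforward (@plan g A) xi.

Definition sinkhorn_step g g' : Prop :=
  exists I : 'I_K,
    [/\ forall i : 'I_K,
          KL (@mu i) (@marginal g i) <= KL (@mu I) (@marginal g I),
        forall xI : X I,
          g' I xI = g I xI + eta * ln (mu xI) - eta * ln (marginal g xI)
      & forall i : 'I_K, i != I -> forall xi : X i, g' i xi = g i xi].

(* Since ties in the argmax may be broken arbitrarily, the algorithm is a
   relation; its iterates are considered beyond the stopping time too. *)
Definition sinkhorn_iterates (g : nat -> forall i : 'I_K, X i -> R) : Prop :=
  (forall (i : 'I_K) (xi : X i), g 0%N i xi = 0) /\
  (forall t : nat, sinkhorn_step (g t) (g t.+1)).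

Definition marginal_error g : R :=
  \sum_(i < K) norm1 (fun xi : X i => mu xi - marginal g xi).

Definition stops_at (g : nat -> forall i : 'I_K, X i -> R) (delta : R)
    (T : nat) : Prop :=
  marginal_error (g T) <= delta /\
  (forall t : nat, (t < T)%N -> delta < marginal_error (g t)).

Definition Cstar (n : nat) : R := fmax (fun i : 'I_K => #|X i|%:R / n%:R).

Definition Rbar (n : nat) : R :=
  L%:R - eta * ln (fmin (fun p : {j : 'I_K & X j} => mu (tagged p)))
  + eta * L%:R * ln (K%:R * Cstar n * n%:R).

End TruncatedMultiSinkhorn.

(* Main.v *)
Require Import Defs.
From HB Require Import structures.
From mathcomp Require Import all_boot all_order all_algebra.
From mathcomp Require Import reals ereal exp.
From mathcomp Require Import boolp sequences ring lra.

Set Implicit Arguments.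
Unset Strict Implicit.
Unset Printing Implicit Defensive.

Import Order.TTheory GRing.Theory Num.Theory.

Local Open Scope ring_scope.

(* Since delta0 may depend on all the data, linear convergence suffices, with no
   control of its rate.  A step on the coordinate I decreases the dual objective by
   KL (mu_I || marginal_I), hence by a multiple of the squared gradient, because the
   marginals are bounded on a sublevel set.  The zero cost of singletons makes the
   objective coercive and, on the bounded region containing the iterates, strongly
   convex, so the remaining gap is at most a multiple of the squared gradient.  Thus
   the gap decays geometrically and T = O(log (1 / delta')), uniformly over the choices
   of argmax.  As Rbar > 0, this is below 14 K^2 Rbar / (eta delta') for small delta',
   and of the ceiling term only nonnegativity is needed. *)

(** * Scalar inequalities and a quantitative form of linear convergence *)

Section RealInequalities.
Variable R : realType.
Implicit Types d m p s u : R.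

(** For d >= -2, squaring e^(d/2) >= 1 + d/2 gives the gain d^2 / 4. Below -2 the linear part - 1 -
    d already exceeds - d / 2, which dominates because - d <= u. The modulus thus decays like 1 / u
    and not like e^(-u). *)
Lemma expR_ge_quadratic u d : 2 <= u -> - u <= d ->
  d ^+ 2 / (2 * u) <= expR d - 1 - d.
Proof.
move=> u2 du; have u0 : 0 < 2 * u by lra.
rewrite ler_pdivrMr//.
have [d2|d2] := leP (-2) d.
  have h : 1 + d + d ^+ 2 / 4 <= expR d.
    have -> : d = d / 2 * 2%:R by lra.
    rewrite expRM_natr; have := expR_ge1Dx (d / 2).
    set e := expR _ => he.
    have : (1 + d / 2) ^+ 2 <= e ^+ 2 by rewrite ler_pXn2r// nnegrE; lra.
    by apply: le_trans; rewrite le_eqVlt; apply/orP; left; apply/eqP; field.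
  have h' : d ^+ 2 / 4 <= expR d - 1 - d by lra.
  have := sqr_ge0 d; nra.
have := expR_gt0 d; nra.
Qed.

(** Write m = a^2 and p = b^2. The bound ln x <= x - 1 at x = b / a puts the squared Hellinger term
    (b - a)^2 below the entropy term, and (m - p)^2 = (a + b)^2 (b - a)^2 with (a + b)^2 <= 4 u. *)
Lemma relative_entropy_ge_sqr p m u : 0 < m -> 0 < p -> m <= u -> p <= u ->
  (m - p) ^+ 2 <= 4 * u * (p - m + m * ln (m / p)).
Proof.
have sqr x : 0 < x -> exists2 y, 0 < y & x = y ^+ 2 :> R.
  by move=> x0; exists (Num.sqrt x); rewrite ?sqrtr_gt0// sqr_sqrtr// ltW.
move=> /sqr[a a0 ->] /sqr[b b0 ->] au bu.
have hl : 2 * (1 - b / a) <= ln (a ^+ 2 / b ^+ 2).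
  have -> : a ^+ 2 / b ^+ 2 = ((b / a) ^+ 2)^-1 by rewrite expr_div_n invf_div.
  have ba : 0 < b / a by rewrite divr_gt0.
  rewrite lnV ?posrE ?exprn_gt0// lnXn// mulr2n.
  have : ln (1 + (b / a - 1)) <= b / a - 1 by apply: le_ln1Dx; lra.
  have -> : 1 + (b / a - 1) = b / a by ring.
  lra.
have h : (b - a) ^+ 2 <= b ^+ 2 - a ^+ 2 + a ^+ 2 * ln (a ^+ 2 / b ^+ 2).
  have : a ^+ 2 * (2 * (1 - b / a)) <= a ^+ 2 * ln (a ^+ 2 / b ^+ 2).
    by rewrite ler_pM2l// exprn_gt0.
  have -> : a ^+ 2 * (2 * (1 - b / a)) = 2 * a ^+ 2 - 2 * a * b.
    by field; rewrite gt_eqF.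
  rewrite sqrrB; lra.
have u0 : 0 <= u by apply: le_trans au; rewrite sqr_ge0.
apply: le_trans (_ : 4 * u * (b - a) ^+ 2 <= _).
  have -> : (a ^+ 2 - b ^+ 2) ^+ 2 = (a + b) ^+ 2 * (b - a) ^+ 2 by ring.
  rewrite ler_wpM2r ?sqr_ge0//.
  have := sqr_ge0 (a - b); rewrite sqrrB sqrrD; lra.
by rewrite ler_wpM2l//; lra.
Qed.

(* Beyond s = 0 the term e^s / 2 dominates s, since e^s >= (1 + s/2)^2 >= 2 s. *)
Lemma expR_sub_linear_bounds m s u : 0 < m -> m <= 1 -> expR s - m * s <= u ->
  - (u / m) <= s <= 2 * u.
Proof.
move=> m0 m1 h; have e0 := expR_gt0 s; apply/andP; split.
  by rewrite lerNl ler_pdivlMr//; nra.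
have [s0|s0] := leP s 0; first by nra.
have : 2 * s <= expR s.
  have -> : s = s / 2 * 2%:R by lra.
  rewrite expRM_natr; have := expR_ge1Dx (s / 2).
  set e := expR _ => he.
  have : (1 + s / 2) ^+ 2 <= e ^+ 2 by rewrite ler_pXn2r// nnegrE; lra.
  have := sqr_ge0 (1 - s / 2); nra.
nra.
Qed.

Lemma expR_sub_linear_ge0 m s : 0 < m -> m <= 1 -> 0 <= expR s - m * s.
Proof.
move=> m0 m1; have := expR_ge1Dx s; have := expR_gt0 s.
have [s0|s0] := leP s 0; nra.
Qed.

Lemma expR_ge_cube s : 0 <= s -> (s / 3) ^+ 3 <= expR s.
Proof.
move=> s0; have {2}-> : s = s / 3 * 3%:R by lra.
rewrite expRM_natr; have := expR_ge1Dx (s / 3) => h.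
by rewrite ler_pXn2r ?nnegrE//; lra.
Qed.

(* |f i| <= f i ^ 2 / (2 s) + s / 2 at s = d / #|I| *)
Lemma sqr_le_card_sum_sqr (I : finType) (f : I -> R) d : 0 < d ->
  d <= \sum_i `|f i| -> d ^+ 2 <= #|I|%:R * \sum_i f i ^+ 2.
Proof.
move=> d0 df.
have [I0|I0] := posnP #|I|.
  by move: df; rewrite big1 => [|i _]; [lra|have := max_card (pred1 i); rewrite card1 I0].
have N0 : 0 < #|I|%:R :> R by rewrite ltr0n.
set N : R := #|I|%:R in N0 *.
have h i : `|f i| <= f i ^+ 2 * (N / (2 * d)) + d / (2 * N).
  rewrite -(real_normK (num_real (f i))).
  have := sqr_ge0 (N * `|f i| - d); set x := `|f i| => hx.
  rewrite -subr_ge0.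
  have -> : x ^+ 2 * (N / (2 * d)) + d / (2 * N) - x = (N * x - d) ^+ 2 / (2 * d * N).
    by field; rewrite !gt_eqF.
  by rewrite divr_ge0// ltW// mulr_gt0//; lra.
have := le_trans df (ler_sum _ (fun i _ => h i)).
rewrite big_split/= -mulr_suml sumr_const -(mulr_natr (d / (2 * N))) -/N.
set S := \sum_i _.
have -> : d / (2 * N) * N = d / 2 by field; rewrite gt_eqF.
move=> {}h; have : d / 2 <= S * (N / (2 * d)) by lra.
rewrite mulrA ler_pdivlMr; last lra.
have -> : d / 2 * (2 * d) = d ^+ 2 by field.
by rewrite mulrC.
Qed.

(* The linear convergence rate leaves T = O(log (1 / delta)), which is bounded here
   through e^s >= (s / 3)^3. *)
Lemma linear_rate_iteration_bound (c C D b : R) : 0 < c -> 0 < C -> 0 < b ->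
  exists2 d0, 0 < d0 & forall (a Q : nat -> R) (d : R) (T : nat),
    (forall t, 0 <= Q t) ->
    (forall t, c * Q t <= a t - a t.+1) ->
    (forall t r, a t - a r <= C * Q t) ->
    (forall t, a 0%N - a t <= D) ->
    0 < d -> d <= d0 -> (forall t, (t < T)%N -> d ^+ 2 <= Q t) ->
    T%:R <= 2 + b / d.
Proof.
move=> c0 C0 b0.
have [e e0 eC] : exists2 e, 0 < e & e * C = c.
  by exists (c / C); rewrite ?divr_gt0// divfK// gt_eqF.
(* [H] will exceed k^3 d^2. If k d > b, then b^3 < d (k^3 d^2) < d H, which d <= b^3 / H excludes; a
   cube is used because it leaves one spare factor d over d^2. The added 1 makes [H] positive and
   the inequality strict. *)
pose H := 27 * `|D| / (c * e ^+ 3) + 1.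
have H0 : 0 < H.
  by rewrite ltr_wpDl// divr_ge0 ?mulr_ge0 ?exprn_ge0 ?(ltW c0) ?(ltW e0).
exists (b ^+ 3 / H); first by rewrite divr_gt0 ?exprn_gt0.
move=> a Q d [|k] Q0 dec gap D_bound d0 dle unstopped.
  by rewrite addr_ge0// ltW// divr_gt0.
have mono t : a t.+1 <= a t.
  by rewrite -subr_ge0; apply: le_trans (dec t); rewrite mulr_ge0// ltW.
(* The gap is taken to [a k.+1], the value just after the last unstopped time, in place of a minimum
   of the objective. *)
have decay t : (t <= k)%N -> a t - a k.+1 <= expR (- e * t%:R) * `|D|.
  elim: t => [_|t IH tk].
    by rewrite mulr0 expR0 mul1r (le_trans (D_bound _))// ler_norm.
  have st : 0 <= a t - a k.+1.
    rewrite subr_ge0; have : (t <= k.+1)%N by rewrite ltnW// ltnW.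
    elim: (k.+1) => [|j IHj]; first by rewrite leqn0 => /eqP->.
    by rewrite leq_eqVlt => /predU1P[<-//|/IHj]; apply: le_trans.
  have step : a t.+1 - a k.+1 <= (1 - e) * (a t - a k.+1).
    have h1 := dec t.
    have h2 : e * (a t - a k.+1) <= c * Q t.
      by rewrite -eC -mulrA ler_pM2l.
    lra.
  apply: le_trans step _.
  have -> : - e * t.+1%:R = - e + - e * t%:R by rewrite -natr1; ring.
  rewrite expRD -mulrA.
  apply: le_trans (_ : expR (- e) * (a t - a k.+1) <= _).
    by rewrite ler_wpM2r// expR_ge1Dx.
  by rewrite ler_wpM2l ?expR_ge0// IH// ltnW.
have [kb|kb] := leP (k%:R * d) b.
  have : k%:R <= b / d by rewrite ler_pdivlMr.
  by rewrite -natr1; lra.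
have k0 : 0 <= k%:R :> R by rewrite ler0n.
have h1 : c * d ^+ 2 <= expR (- e * k%:R) * `|D|.
  apply: le_trans (decay k (leqnn k)); apply: le_trans (dec k).
  by rewrite ler_pM2l// unstopped.
have h2 : (e * k%:R / 3) ^+ 3 * (c * d ^+ 2) <= `|D|.
  rewrite mulNr expRN in h1.
  have h := @expR_ge_cube (e * k%:R) (mulr_ge0 (ltW e0) k0).
  apply: le_trans (_ : expR (e * k%:R) * (c * d ^+ 2) <= _).
    apply: ler_wpM2r => //.
    by apply: mulr_ge0; [exact: ltW|exact: sqr_ge0].
  by rewrite (mulrC (expR _)) -ler_pdivlMr ?expR_gt0// (mulrC `|D|).
have h3 : k%:R ^+ 3 * d ^+ 2 < H.
  apply: le_lt_trans (_ : 27 * `|D| / (c * e ^+ 3) < _); last by rewrite ltrDl.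
  rewrite ler_pdivlMr ?mulr_gt0 ?exprn_gt0//.
  have -> : k%:R ^+ 3 * d ^+ 2 * (c * e ^+ 3)
          = 27 * ((e * k%:R / 3) ^+ 3 * (c * d ^+ 2)) by field.
  by rewrite ler_pM2l.
have h4 : b ^+ 3 < d * H.
  apply: lt_trans (_ : (k%:R * d) ^+ 3 < _).
    by rewrite ltr_pXn2r ?nnegrE ?ltW// (lt_trans b0).
  have -> : (k%:R * d) ^+ 3 = d * (k%:R ^+ 3 * d ^+ 2) by ring.
  by rewrite ltr_pM2l.
by move: dle; rewrite ler_pdivlMr// leNgt h4.
Qed.

End RealInequalities.

(** * Sums over the coordinates of a tuple, and their pairing with pushforwards *)

Section Coordinates.
Variables (R : realType) (K : nat) (X : 'I_K -> finType).
Implicit Types (A : {set 'I_K}) (F : forall i : 'I_K, X i -> R).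

Lemma sum_coord A (x : XA X A) F :
  \sum_(j : {i : 'I_K | i \in A}) F (val j) (x j)
  = \sum_(i in A) \sum_(xi : X i | has_coord x xi) F i xi.
Proof.
rewrite [RHS]big_sub; apply: eq_bigr => -[i iA] _ /=.
rewrite (big_pred1 (x (exist _ i iA)))// => xi.
by rewrite (has_coordE x iA) eq_sym.
Qed.

(** With a single term, nonlinear functions commute with the sum. The witnesses precede [F], so
    several families can be evaluated at the same point. *)
Lemma sum_coord_card1 A (x : XA X A) : #|A| == 1%N ->
  exists (i : 'I_K) (xi : X i), forall F,
    \sum_(j : {i : 'I_K | i \in A}) F (val j) (x j) = F i xi.
Proof.
move=> /cards1P[i Ai]; subst A; exists i, (x (exist _ i (set11 i))) => F.
rewrite sum_coord big_set1 (big_pred1 (x (exist _ i (set11 i))))// => xi.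
by rewrite (has_coordE x (set11 i)) eq_sym.
Qed.

Lemma ex_singleton_coord (i : 'I_K) (xi : X i) :
  exists x : XA X [set i], has_coord x xi.
Proof.
pose f (j : {k : 'I_K | k \in [set i]}) : X (val j) :=
  eq_rect i (fun k => X k : Type) xi (val j) (esym (set1P (valP j))).
exists (finfun f); rewrite (has_coordE _ (set11 i)) ffunE /f /=.
by rewrite (eq_irrelevance (esym _) (erefl i)).
Qed.

(** Pushforward is adjoint to the map sending a family [F] to its sum along a tuple. This turns sums
    over tuples into sums against marginals. *)
Lemma sum_pushforward (L : nat) (p : forall A, XA X A -> R) F :
  \sum_(A in SKL K L) \sum_(x : XA X A)
     p A x * (\sum_(j : {i : 'I_K | i \in A}) F (val j) (x j))
  = \sum_(i < K) \sum_(xi : X i)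
     (\sum_(A in SKLi L i) pushforward (p A) xi) * F i xi.
Proof.
under [RHS]eq_bigr => i _.
  under eq_bigr => xi _ do rewrite mulr_suml.
  rewrite exchange_big/=; over.
rewrite (exchange_big_dep (fun A => A \in SKL K L))/=; last first.
  by move=> i A _; rewrite inE => /andP[].
apply: eq_bigr => A AS.
rewrite (eq_bigl (fun i => i \in A)); last by move=> i; rewrite inE AS.
under [RHS]eq_bigr => i _.
  under eq_bigr => xi _ do rewrite mulr_suml.
  rewrite (exchange_big_dep xpredT)//=; over.
rewrite exchange_big/=; apply: eq_bigr => x _.
rewrite sum_coord mulr_sumr; apply: eq_bigr => i _.
by rewrite mulr_sumr.
Qed.

End Coordinates.

(** * Plans and marginals: exact decrease of a step, and strong convexity *)

Section Plans.
Variables (R : realType) (K : nat) (X : 'I_K -> finType).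
Variables (mu : forall i : 'I_K, X i -> R)
  (c : forall A : {set 'I_K}, XA X A -> \bar R) (eta : R) (L : nat).
Hypothesis (eta_gt0 : 0 < eta).
Implicit Types (A : {set 'I_K}) (g : forall i : 'I_K, X i -> R).

Local Notation plan := (plan c eta).
Local Notation marginal := (marginal c eta L).

Lemma plan_ge0 g A (x : XA X A) : 0 <= plan g x.
Proof. exact/fine_ge0/expeR_ge0. Qed.

Lemma plan_shift g g' A (x : XA X A) :
  plan g' x = plan g x *
    expR (\sum_(j : {i : 'I_K | i \in A})
            (g' (val j) (x j) - g (val j) (x j)) / eta).
Proof.
rewrite -mulr_suml sumrB /plan.
move: (\sum_j _) (\sum_j _) => s s'; case: (c x) => [r| |] /=.
- by rewrite -expRD; congr expR; field; rewrite gt_eqF.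
- by rewrite gt0_muleNy ?lte_fin ?invr_gt0//= mul0r.
(* At cost -oo the exponential is +oo, which [fine] sends to 0, so both sides vanish here too. *)
- by rewrite gt0_muley ?lte_fin ?invr_gt0//= mul0r.
Qed.

(* Only singletons provide strong convexity: only their cost is known to be finite. *)
Definition singleton_plan g A (x : XA X A) : R :=
  if #|A| == 1%N then plan g x else 0.

Lemma singleton_plan_ge0 g A (x : XA X A) : 0 <= singleton_plan g x.
Proof. by rewrite /singleton_plan; case: ifP => // _; exact: plan_ge0. Qed.

Lemma singleton_plan_le g A (x : XA X A) : singleton_plan g x <= plan g x.
Proof. by rewrite /singleton_plan; case: ifP => // _; exact: plan_ge0. Qed.

Hypothesis (L_ge1 : (1 <= L)%N).
Hypothesis (c_singleton : forall (i : 'I_K) (x : XA X [set i]), c x = 0%E).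

(** The tuple over [[set i]] with coordinate [xi] has cost 0 and alone contributes the left-hand
    side. This gives positivity of the marginals, coercivity and the strong convexity modulus. *)
Lemma singleton_marginal_ge g (i : 'I_K) (xi : X i) :
  expR ((g i xi - 1) / eta)
  <= \sum_(A in SKLi L i) pushforward (@singleton_plan g A) xi.
Proof.
have iS : [set i] \in SKLi L i by rewrite !inE cards1 L_ge1 -card_gt0 cards1 eqxx.
rewrite (bigD1 [set i])//= ler_wpDr//.
  by apply: sumr_ge0 => A _; apply: sumr_ge0 => x _; exact: singleton_plan_ge0.
have [x xxi] := ex_singleton_coord xi.
rewrite /pushforward (bigD1 x)//= ler_wpDr//.
  by apply: sumr_ge0 => y _; exact: singleton_plan_ge0.
rewrite /singleton_plan cards1 eqxx /plan c_singleton adde0 sum_coord big_set1.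
rewrite (big_pred1 xi) => [|y]; last first.
  by move: xxi; rewrite !(has_coordE _ (set11 i)) => /eqP ->; rewrite eq_sym.
by rewrite -EFinB -EFinM /= mulrC.
Qed.

Lemma singleton_marginal_le g (i : 'I_K) (xi : X i) :
  \sum_(A in SKLi L i) pushforward (@singleton_plan g A) xi <= marginal g xi.
Proof.
apply: ler_sum => A _; apply: ler_sum => x _; exact: singleton_plan_le.
Qed.

Lemma marginal_gt0 g (i : 'I_K) (xi : X i) : 0 < marginal g xi.
Proof.
apply: lt_le_trans (singleton_marginal_le _ _).
by apply: lt_le_trans (singleton_marginal_ge _ _); exact: expR_gt0.
Qed.

Definition total_plan g : R := \sum_(A in SKL K L) \sum_(x : XA X A) plan g x.

Lemma marginal_le_total g (i : 'I_K) (xi : X i) : marginal g xi <= total_plan g.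
Proof.
rewrite /marginal /total_plan [leRHS](big_setID (SKLi L i))/=.
have /setIidPr -> : SKLi L i \subset SKL K L.
  by apply/subsetP => A; rewrite inE => /andP[].
rewrite ler_wpDr//.
  by apply: sumr_ge0 => A _; apply: sumr_ge0 => x _; exact: plan_ge0.
apply: ler_sum => A _; rewrite /pushforward [leRHS](bigID (fun x => has_coord x xi))/=.
by rewrite lerDl; apply: sumr_ge0 => x _; exact: plan_ge0.
Qed.

(** Pairing with the constant 1 counts a tuple over A with weight #|A|; restricted to singleton
    plans the weight is 1, so no mass is counted twice. *)
Lemma sum_singleton_le_total g :
  \sum_(i < K) \sum_(xi : X i) expR ((g i xi - 1) / eta) <= total_plan g.
Proof.
apply: le_trans (_ : \sum_(A in SKL K L) \sum_(x : XA X A) singleton_plan g x *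
  (\sum_(j : {i : 'I_K | i \in A}) (fun i (_ : X i) => 1) (val j) (x j)) <= _).
  rewrite (sum_pushforward _ _ (fun i (_ : X i) => 1)).
  apply: ler_sum => i _; apply: ler_sum => xi _.
  by rewrite mulr1; exact: singleton_marginal_ge.
apply: ler_sum => A _; apply: ler_sum => x _; rewrite /singleton_plan.
case: ifPn => [/(sum_coord_card1 R x)[i [xi /(_ (fun i (_ : X i) => 1)) ->]]|_].
  by rewrite mulr1.
by rewrite mul0r plan_ge0.
Qed.

Lemma total_plan_sub g g' :
  total_plan g' - total_plan g = \sum_(A in SKL K L) \sum_(x : XA X A)
    plan g x * (expR (\sum_(j : {i : 'I_K | i \in A})
       (fun i (xi : X i) => (g' i xi - g i xi) / eta) (val j) (x j)) - 1).
Proof.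
rewrite -sumrB; apply: eq_bigr => A _; rewrite -sumrB; apply: eq_bigr => x _.
by rewrite (plan_shift g g') mulrBr mulr1.
Qed.

Lemma dual_objective_sub g g' :
  dual_objective mu c eta L g' - dual_objective mu c eta L g =
  total_plan g' - total_plan g
  - \sum_(i < K) \sum_(xi : X i) (g' i xi - g i xi) / eta * mu xi.
Proof.
rewrite /dual_objective -!/(total_plan _).
under [in RHS]eq_bigr => i _.
  under eq_bigr => xi _ do rewrite mulrBl mulrBl.
  rewrite sumrB; over.
rewrite sumrB; ring.
Qed.

(** The update rescales the marginal at [I] to mu exactly. The change of total mass is the first sum
    of [KL], and the change of the linear term is its logarithmic sum. *)
Lemma step_decrease g g' : (forall (i : 'I_K) (x : X i), 0 < mu x) ->
  sinkhorn_step mu c eta L g g' ->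
  exists2 I : 'I_K,
    forall i, KL (@mu i) (@marginal g i) <= KL (@mu I) (@marginal g I) &
    dual_objective mu c eta L g - dual_objective mu c eta L g'
    = KL (@mu I) (@marginal g I).
Proof.
move=> mu_gt0 [I [Imax gI gi]]; exists I => //.
pose d i (xi : X i) := (g' i xi - g i xi) / eta.
have dI xi : d I xi = ln (mu xi / marginal g xi).
  rewrite /d gI ln_div ?posrE ?marginal_gt0//; field; exact: lt0r_neq0.
have di i xi : i != I -> d i xi = 0 by move=> iI; rewrite /d gi// subrr mul0r.
have tot : total_plan g' - total_plan g
    = \sum_(xi : X I) (mu xi - marginal g xi).
  rewrite total_plan_sub.
  (* At most one coordinate of the increment is nonzero, so the exponential of the sum minus 1
     equals the sum of the exponentials minus 1, which can be paired with marginals. *)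
  transitivity (\sum_(A in SKL K L) \sum_(x : XA X A) plan g x *
    (\sum_(j : {i : 'I_K | i \in A})
      (fun i (xi : X i) => expR (d i xi) - 1) (val j) (x j))).
    apply: eq_bigr => A _; apply: eq_bigr => x _; congr (_ * _).
    rewrite (sum_coord x d) (sum_coord x (fun i xi => expR (d i xi) - 1)).
    have F0 (F : forall i, X i -> R) : (forall i xi, i != I -> F i xi = 0) ->
      \sum_(i in A) \sum_(xi : X i | has_coord x xi) F i xi =
      (I \in A)%:R * \sum_(xi : X I | has_coord x xi) F I xi.
      move=> F0; case: (boolP (I \in A)) => IA.
        rewrite mul1r (bigD1 I)//= [X in _ + X]big1 ?addr0// => i /andP[_ iI].
        by apply: big1 => xi _; exact: F0.
      rewrite mul0r big1// => i iA; apply: big1 => xi _; apply: F0.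
      by apply: contraNneq IA => <-.
    rewrite !F0; first last.
    - exact: di.
    - by move=> i xi iI; rewrite di// expR0 subrr.
    case: (boolP (I \in A)) => IA; last by rewrite !mul0r expR0 subrr.
    by rewrite !mul1r; rewrite !(big_pred1 (x (exist _ I IA)))// => xi;
      rewrite has_coordE eq_sym.
  rewrite (sum_pushforward L (@Defs.plan _ _ _ c eta g)
    (fun i xi => expR (d i xi) - 1)) (bigD1 I)//= [X in _ + X]big1 ?addr0; last first.
    by move=> i iI; apply: big1 => xi _; rewrite di// expR0 subrr mulr0.
  apply: eq_bigr => xi _; rewrite dI lnK ?posrE ?divr_gt0 ?marginal_gt0//.
  rewrite -/(marginal g xi); field; exact/lt0r_neq0/marginal_gt0.
rewrite -opprB dual_objective_sub tot (bigD1 I)//= [X in _ - (_ + X)]big1 ?addr0.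
  rewrite /KL opprB addrC -sumrN; congr (_ + _).
    by apply: eq_bigr => xi _; rewrite opprB.
  by apply: eq_bigr => xi _; rewrite -/(d I xi) dI mulrC.
by move=> i iI; apply: big1 => xi _; rewrite gi// subrr !mul0r.
Qed.

(* On the box |g' - g| <= eta u the singleton plans make the objective strongly
   convex, so the gap is bounded by the squared gradient. *)
Lemma gap_le_sqr_gradient g g' (u r : R) : 2 <= u -> 0 < r ->
  (forall (i : 'I_K) (xi : X i), - u <= (g' i xi - g i xi) / eta) ->
  (forall (i : 'I_K) (xi : X i), (g' i xi - g i xi) / eta <= u) ->
  (forall (i : 'I_K) (xi : X i), r <= expR ((g i xi - 1) / eta)) ->
  dual_objective mu c eta L g - dual_objective mu c eta L g'
  <= u / (2 * r) * \sum_(i < K) \sum_(xi : X i) (mu xi - marginal g xi) ^+ 2.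
Proof.
move=> u2 r0 du ud rg; have u0 : 0 < u by lra.
pose d i (xi : X i) := (g' i xi - g i xi) / eta.
have convex : \sum_(i < K) \sum_(xi : X i)
    (marginal g xi * d i xi + r * (d i xi ^+ 2 / (2 * u)))
    <= total_plan g' - total_plan g.
  pose q i (xi : X i) := d i xi ^+ 2 / (2 * u).
  (* Every plan contributes its tangent line by e^y >= 1 + y; the quadratic gain is taken from
     singletons only, where the sum over [j] has one term. *)
  apply: le_trans (_ : \sum_(A in SKL K L) \sum_(x : XA X A)
    (plan g x * (\sum_(j : {i : 'I_K | i \in A}) d (val j) (x j)) +
     singleton_plan g x * (\sum_(j : {i : 'I_K | i \in A}) q (val j) (x j))) <= _).
    under [leRHS]eq_bigr do rewrite big_split.
    rewrite big_split/= !sum_pushforward -big_split; apply: ler_sum => i _ /=.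
    rewrite -big_split/=; apply: ler_sum => xi _; rewrite lerD2l.
    apply: ler_wpM2r; first by rewrite /q divr_ge0 ?sqr_ge0//; lra.
    exact: le_trans (rg _ _) (singleton_marginal_ge _ _).
  rewrite total_plan_sub; apply: ler_sum => A _; apply: ler_sum => x _.
  rewrite /singleton_plan; case: ifPn => [/(sum_coord_card1 R x)[i [xi ix]]|_].
    rewrite !ix -mulrDr; apply: ler_wpM2l; first exact: plan_ge0.
    by have := expR_ge_quadratic u2 (du i xi); rewrite -/(d i xi) /q; lra.
  rewrite mul0r addr0; apply: ler_wpM2l; first exact: plan_ge0.
  by rewrite lerBrDl expR_ge1Dx.
rewrite -opprB dual_objective_sub lerNl.
apply: le_trans (lerD convex (lexx _)).
rewrite -sumrB mulr_sumr -sumrN; apply: ler_sum => i _.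
rewrite -sumrB mulr_sumr -sumrN; apply: ler_sum => xi _; rewrite -/(d i xi).
set p := marginal g xi; set m := mu xi; set y := d i xi.
rewrite -subr_ge0.
(* The bound is the minimum of a quadratic in [y], so the difference is a perfect square. *)
have -> : p * y + r * (y ^+ 2 / (2 * u)) - y * m
    - - (u / (2 * r) * (m - p) ^+ 2)
  = (r * y - u * (m - p)) ^+ 2 / (2 * r * u).
  by field; rewrite !gt_eqF.
by rewrite divr_ge0 ?sqr_ge0// !mulr_ge0 ?ltW//.
Qed.

(** * Coercivity: bounds on the sublevel sets of the dual objective *)

Hypothesis (mu_gt0 : forall (i : 'I_K) (x : X i), 0 < mu x).
Hypothesis (mu_mass : \sum_(i < K) norm1 (@mu i) = 1).

Lemma sum_mu : \sum_(i < K) \sum_(xi : X i) mu xi = 1.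
Proof.
rewrite -mu_mass; apply: eq_bigr => i _; apply: eq_bigr => xi _.
by rewrite ger0_norm// ltW.
Qed.

Lemma sum_scale_mu (k : R) : \sum_(i < K) \sum_(xi : X i) k * mu xi = k.
Proof. by under eq_bigr do rewrite -mulr_sumr; rewrite -mulr_sumr sum_mu mulr1. Qed.

Lemma mu_le1 (i : 'I_K) (xi : X i) : mu xi <= 1.
Proof.
rewrite -sum_mu (bigD1 i)//= (bigD1 xi)//= -addrA lerDl addr_ge0//.
  by apply: sumr_ge0 => *; exact: ltW.
by apply: sumr_ge0 => *; apply: sumr_ge0 => *; exact: ltW.
Qed.

(** Only singletons are kept from the total mass. Since mu has mass 1, centring the potentials at 1
    costs exactly 1 / eta, and the lower bound becomes separable. *)
Lemma dual_objective_ge g :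
  \sum_(i < K) \sum_(xi : X i)
     (expR ((g i xi - 1) / eta) - mu xi * ((g i xi - 1) / eta)) - eta^-1
  <= dual_objective mu c eta L g.
Proof.
have := sum_singleton_le_total g.
rewrite /dual_objective -/(total_plan g) => h.
have -> : \sum_(i < K) \sum_(xi : X i) g i xi / eta * mu xi
  = \sum_(i < K) \sum_(xi : X i) mu xi * ((g i xi - 1) / eta) + eta^-1.
  rewrite -[X in _ + X]sum_scale_mu -big_split; apply: eq_bigr => i _ /=.
  rewrite -big_split; apply: eq_bigr => xi _ /=; ring.
under eq_bigr do rewrite sumrB.
rewrite sumrB; lra.
Qed.

(** The summands in [dual_objective_ge] are nonnegative, so each is at most M, and the scalar
    estimate confines each normalized potential. The total mass, which dominates every marginal, is
    the objective plus a linear term of at most 2 M + 1 / eta, whence 3 M. *)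
Lemma sublevel_bounds g M : dual_objective mu c eta L g + eta^-1 <= M ->
  [/\ 0 <= M,
      forall (i : 'I_K) (xi : X i), - (M / mu xi) <= (g i xi - 1) / eta <= 2 * M
    & forall (i : 'I_K) (xi : X i), marginal g xi <= 3 * M].
Proof.
move=> gM; pose s i (xi : X i) := (g i xi - 1) / eta.
pose f i (xi : X i) := expR (s i xi) - mu xi * s i xi.
have f_ge0 i xi : 0 <= f i xi by apply: expR_sub_linear_ge0 => //; exact: mu_le1.
have sumf : \sum_(i < K) \sum_(xi : X i) f i xi <= M.
  by have := dual_objective_ge g; rewrite -/(f _ _); lra.
have fM i xi : f i xi <= M.
  apply: le_trans sumf; rewrite (bigD1 i)//= (bigD1 xi)//= -addrA lerDl addr_ge0//.
    exact: sumr_ge0.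
  by apply: sumr_ge0 => j _; exact: sumr_ge0.
have M_ge0 : 0 <= M.
  by apply: le_trans sumf; apply: sumr_ge0 => j _; exact: sumr_ge0.
have sM i xi : - (M / mu xi) <= s i xi <= 2 * M.
  by apply: expR_sub_linear_bounds => //; [exact: mu_le1|exact: fM].
split=> // i xi; apply: le_trans (marginal_le_total g xi) _.
have : \sum_(i < K) \sum_(xi : X i) g i xi / eta * mu xi <= 2 * M + eta^-1.
  rewrite -[leRHS]sum_scale_mu; apply: ler_sum => j _.
  apply: ler_sum => y _; apply: ler_wpM2r; first exact: ltW.
  have /andP[_] := sM j y; rewrite /s mulrBl mul1r; lra.
by move: gM; rewrite /dual_objective -/(total_plan g); lra.
Qed.

End Plans.

Lemma fmin_ge0 (R : realType) (I : finType) (f : I -> R) :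
  (forall i, 0 <= f i) -> 0 <= fmin f.
Proof.
move=> f0; apply: le_bigmin => [|i _]; last exact: f0.
rewrite /codom /image_mem; case: (enum I) => [|i s] /=; first exact: lexx.
exact: f0.
Qed.

(** * The squared gradient against the decrease of a step and the stopping error *)

Section Iterates.
Variables (R : realType) (K L : nat) (X : 'I_K -> finType).
Variables (mu : forall i : 'I_K, X i -> R)
  (c : forall A : {set 'I_K}, XA X A -> \bar R) (eta : R).
Hypothesis (eta_gt0 : 0 < eta).
Hypothesis (L_ge1 : (1 <= L)%N).
Hypothesis (c_singleton : forall (i : 'I_K) (x : XA X [set i]), c x = 0%E).
Hypothesis (mu_gt0 : forall (i : 'I_K) (x : X i), 0 < mu x).

Local Notation marginal := (marginal c eta L).
Local Notation G := (dual_objective mu c eta L).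

(** This is eta^2 times the squared Euclidean norm of the gradient of [dual_objective]. *)
Definition sqr_error (g : forall i : 'I_K, X i -> R) : R :=
  \sum_(i < K) \sum_(xi : X i) (mu xi - marginal g xi) ^+ 2.

Lemma sqr_error_ge0 g : 0 <= sqr_error g.
Proof. by apply: sumr_ge0 => i _; apply: sumr_ge0 => xi _; exact: sqr_ge0. Qed.

(** By the greedy choice each of the K divergences is at most the decrease; this is the origin of
    the factor K. *)
Lemma step_decrease_ge g g' u : 0 <= u -> sinkhorn_step mu c eta L g g' ->
  (forall (i : 'I_K) (xi : X i), mu xi <= u) ->
  (forall (i : 'I_K) (xi : X i), marginal g xi <= u) ->
  sqr_error g <= 4 * u * K%:R * (G g - G g').
Proof.
move=> u0 /step_decrease[]// I Imax -> muu mgu.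
apply: le_trans (_ : \sum_(i < K) 4 * u * KL (@mu i) (@marginal g i) <= _).
  apply: ler_sum => i _; rewrite /KL -big_split mulr_sumr; apply: ler_sum => xi _.
  by apply: relative_entropy_ge_sqr => //; exact: marginal_gt0.
rewrite -mulr_sumr -[leRHS]mulrA ler_wpM2l ?mulr_ge0//.
apply: le_trans (ler_sum _ (fun i _ => Imax i)) _.
by rewrite sumr_const card_ord mulr_natl.
Qed.

(** The stopping error is an l1 norm over the disjoint union of the X i, so Cauchy-Schwarz applies
    with its number of points. *)
Lemma sqr_marginal_error d g : 0 < d -> d <= marginal_error mu c eta L g ->
  d ^+ 2 <= #|{: {i : 'I_K & X i}}|%:R * sqr_error g.
Proof.
rewrite /marginal_error /sqr_error /norm1 !sig_big_dep/=.
exact: (@sqr_le_card_sum_sqr _ _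
  (fun p : {i : 'I_K & X i} => mu (tagged p) - marginal g (tagged p))).
Qed.

End Iterates.

(** * Positivity of [Rbar] and assembly of the iteration bound *)

Lemma Rbar_gt0 (R : realType) (K L n : nat) (X : 'I_K -> finType)
    (mu : forall i : 'I_K, X i -> R) (eta : R) :
  (0 < K)%N -> (0 < L)%N -> (0 < n)%N -> (forall i, (0 < #|X i|)%N) ->
  (forall (i : 'I_K) (xi : X i), mu i xi <= 1) -> 0 < eta ->
  0 < Rbar mu eta L n.
Proof.
move=> K0 L0 n0 X0 mu1 eta0.
have [i0] : exists i : 'I_K, true by exists (Ordinal K0).
have /card_gt0P[x0 _] := X0 i0 => _.
have h1 : ln (fmin (fun p : {j : 'I_K & X j} => mu (tag p) (tagged p))) <= 0.
  apply: ln_le0; apply: le_trans (mu1 i0 x0).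
  exact: (bigmin_le _ (Tagged (fun j => X j : Type) x0)).
(* The argument is at least 1, because K >= 1 and [Cstar] times n is at least #|X i0| >= 1. *)
have h2 : 0 <= ln (K%:R * Cstar R X n * n%:R).
  apply: ln_ge0; rewrite -mulrA -[leLHS]mulr1 ler_pM ?ler1n//.
  apply: le_trans (_ : #|X i0|%:R / n%:R * n%:R <= _).
    by rewrite divfK ?pnatr_eq0 -?lt0n// ler1n.
  by rewrite ler_wpM2r//; exact: (le_bigmax _ _ i0).
have L1 : 0 < L%:R :> R by rewrite ltr0n.
rewrite /Rbar; have := mulr_ge0 (mulr_ge0 (ltW eta0) (ltW L1)) h2.
have : 0 <= - (eta * ln (fmin (fun p : {j : 'I_K & X j} => mu (tag p) (tagged p)))).
  by rewrite oppr_ge0 pmulr_rle0.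
lra.
Qed.

Theorem theorem3p8 (R : realType) (K L n : nat) (X : 'I_K -> finType)
  (mu : forall i : 'I_K, X i -> R)
  (c : forall A : {set 'I_K}, XA X A -> \bar R) (eta : R)
  (K_ge1 : (1 <= K)%N) (L_ge1 : (1 <= L)%N) (L_leK : (L <= K)%N)
  (n_ge1 : (1 <= n)%N)
  (X_nonempty : forall i : 'I_K, (0 < #|X i|)%N)
  (mu_gt0 : forall (i : 'I_K) (x : X i), 0 < mu i x)
  (mu_mass : \sum_(i < K) norm1 (mu i) = 1)
  (c_ge0 : forall A : {set 'I_K}, A \in SKL K L ->
     forall x : XA X A, (0 <= c A x)%E)
  (c_singleton : forall (i : 'I_K) (x : XA X [set i]), c [set i] x = 0%E)
  (eta_gt0 : 0 < eta) :
  exists2 delta0 : R, 0 < delta0 &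
  forall delta' : R, 0 < delta' -> delta' <= delta0 ->
  forall g : nat -> forall i : 'I_K, X i -> R,
    sinkhorn_iterates mu c eta L g ->
    exists2 T : nat, stops_at mu c eta L g delta' T &
      T%:R <= 2
        + (Num.ceil (dual_objective mu c eta L (g 0%N)
                     / fmin (fun i : 'I_K => norm1 (mu i))))%:~R
        + 14 * K%:R ^+ 2 * Rbar mu eta L n / (eta * delta').
Proof.
have mu1 := mu_le1 mu_gt0 mu_mass.
pose M := dual_objective mu c eta L (fun _ _ => 0) + eta^-1.
have [M_ge0 _ _] := sublevel_bounds L_ge1 c_singleton mu_gt0 mu_mass (lexx M).
have [m m0 mmu] : exists2 m : R, 0 < m & forall i (xi : X i), m <= mu i xi.
  exists (\big[Num.min/1]_(p : {i : 'I_K & X i}) mu (tag p) (tagged p)).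
    by apply: lt_bigmin.
  by move=> i xi; exact: (bigmin_le _ (Tagged (fun j => X j : Type) xi)).
pose N : R := #|{: {i : 'I_K & X i}}|%:R.
have N0 : 0 < N.
  rewrite ltr0n; have /card_gt0P[x0 _] := X_nonempty (Ordinal K_ge1).
  by apply/card_gt0P; exists (Tagged (fun j => X j : Type) x0).
have K0 : 0 < K%:R :> R by rewrite ltr0n.
have Mm_ge0 : 0 <= M / m by rewrite divr_ge0// ltW.
(* [u] dominates mu <= 1 and the marginals <= 3 M. Normalized potentials lie in [- M / m, 2 M], so
   [w] bounds their differences, the extra 2 serving [expR_ge_quadratic]; [r] bounds the singleton
   terms below. [M] and [m] depend only on the data, so the constants serve all runs. *)
pose u : R := 1 + 3 * M; pose w : R := 2 + 2 * M + M / m; pose r := expR (- (M / m)).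
have u0 : 0 < u by rewrite /u; lra.
have w2 : 2 <= w by rewrite /w; lra.
have R0 := Rbar_gt0 K_ge1 L_ge1 n_ge1 X_nonempty mu1 eta_gt0.
have b0 : 0 < 14 * K%:R ^+ 2 * Rbar mu eta L n / eta.
  by rewrite divr_gt0// mulr_gt0// mulr_gt0// exprn_gt0.
(* Both rates are divided by [N] because [Q] below is N times [sqr_error], the quantity that
   dominates d^2. *)
have c0 : 0 < (4 * u * K%:R * N)^-1 by rewrite invr_gt0 !mulr_gt0.
have C0 : 0 < w / (2 * r) / N.
  by rewrite !divr_gt0// ?mulr_gt0 ?expR_gt0//; lra.
have [d0 d0_gt0 bound] := linear_rate_iteration_bound M c0 C0 b0.
exists d0 => // d d_gt0 dd0 g [g0 gstep].
have Gg0 : g 0%N = fun _ _ => 0.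
  by apply: functional_extensionality_dep => i; apply: funext => xi.
pose a t := dual_objective mu c eta L (g t).
have step t : a t + eta^-1 <= M ->
    sqr_error L mu c eta (g t) <= 4 * u * K%:R * (a t - a t.+1).
  move=> /(sublevel_bounds L_ge1 c_singleton mu_gt0 mu_mass)[_ _ mg].
  apply: step_decrease_ge => // [|i xi|i xi]; first exact: ltW.
    by have := mu1 i xi; rewrite /u; lra.
  by have := mg i xi; rewrite /u; lra.
(* The decrease estimate holds inside the sublevel set, and the decrease keeps the next iterate
   inside. *)
have aM t : a t + eta^-1 <= M.
  elim: t => [|t IH]; first by rewrite /a Gg0.
  have := le_trans (sqr_error_ge0 L mu c eta (g t)) (step t IH).
  by rewrite pmulr_rge0 ?mulr_gt0//; lra.
have unstopped_bound T :
    (forall t, (t < T)%N -> d < marginal_error mu c eta L (g t)) ->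
    T%:R <= 2 + 14 * K%:R ^+ 2 * Rbar mu eta L n / eta / d.
  move=> unstopped.
  apply: (bound a (fun t => N * sqr_error L mu c eta (g t))) => //.
  - by move=> t; apply: mulr_ge0; [exact: ltW|exact: sqr_error_ge0].
  - by move=> t; rewrite ler_pdivrMl ?mulr_gt0// [leRHS]mulrAC (mulrC N) ler_pM2r// step.
  - move=> t t'; rewrite mulrA divfK ?gt_eqF//.
    have [_ st _] := sublevel_bounds L_ge1 c_singleton mu_gt0 mu_mass (aM t).
    have [_ st' _] := sublevel_bounds L_ge1 c_singleton mu_gt0 mu_mass (aM t').
    have lo v i xi : - (M / mu i xi) <= v -> - (M / m) <= v.
      by apply: le_trans; rewrite lerN2 ler_wpM2l// lef_pV2 ?posrE.
    have dE i xi : (g t' i xi - g t i xi) / eta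
      = (g t' i xi - 1) / eta - (g t i xi - 1) / eta by ring.
    apply: gap_le_sqr_gradient => //; first exact: expR_gt0.
    + move=> i xi; rewrite dE; have /andP[_ ?] := st i xi.
      have /andP[/lo ? _] := st' i xi; rewrite /w; lra.
    + move=> i xi; rewrite dE; have /andP[/lo ? _] := st i xi.
      have /andP[_ ?] := st' i xi; rewrite /w; lra.
    + by move=> i xi; rewrite ler_expR; have /andP[/lo] := st i xi.
  (* Taking the level of [g t] itself as bound yields a t + 1 / eta >= 0, so the total decrease is
     at most M. *)
  - move=> t; have [at0 _ _] :=
      sublevel_bounds L_ge1 c_singleton mu_gt0 mu_mass (lexx (a t + eta^-1)).
    have := aM 0%N; lra.
  - by move=> t tT; apply: sqr_marginal_error => //; exact/ltW/unstopped.
(* If the criterion were never met, [unstopped_bound] would bound every natural number. *)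
have stop : exists t, marginal_error mu c eta L (g t) <= d.
  apply: contrapT => nostop.
  have := @archi_boundP _ (2 + 14 * K%:R ^+ 2 * Rbar mu eta L n / eta / d).
  have b_ge0 : 0 <= 2 + 14 * K%:R ^+ 2 * Rbar mu eta L n / eta / d.
    by rewrite addr_ge0// ltW// divr_gt0.
  move=> /(_ b_ge0); rewrite ltNge unstopped_bound// => t _.
  by rewrite ltNge; apply/negP => h; apply: nostop; exists t.
case: (ex_minnP stop) => T ET Tmin.
have unstopped t : (t < T)%N -> d < marginal_error mu c eta L (g t).
  by move=> tT; rewrite ltNge; apply: contraTN tT => /Tmin; rewrite -leqNgt.
exists T; first by split.
apply: le_trans (unstopped_bound T unstopped) _.
rewrite (_ : _ / (eta * d) = 14 * K%:R ^+ 2 * Rbar mu eta L n / eta / d); last first.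
  by rewrite invfM [LHS]mulrA.
(* A ceiling is nonnegative as soon as its argument exceeds -1. Here the argument is nonnegative: at
   zero potentials the linear term vanishes and only a sum of plans remains. *)
rewrite lerD2r lerDl ler0z ceil_ge0.
apply: lt_le_trans (_ : 0 <= _); first by rewrite ltrN10.
apply: divr_ge0; last by apply: fmin_ge0 => i; apply: sumr_ge0.
rewrite /dual_objective [X in _ - X]big1 ?subr0 => [|i _]; last first.
  by apply: big1 => xi _; rewrite g0 !mul0r.
by apply: sumr_ge0 => A _; apply: sumr_ge0 => x _; exact: plan_ge0.
Qed.
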